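(* For every integer $l\ge 1$, let $\mathbf{MAJ}_{2l+1}:\{0,1\}^{2l+1}\to\{0,1\}$ be the majority function. Then $$L(\mathbf{MAJ}_{2l+1}) \geq \frac{(l+1)^2}{1-\epsilon(l)}, \qquad \text{where } \epsilon(l) = \frac{l^2(l+1)}{6\binom{2l+1}{l}}.$$
   Context: $\mathbf{MAJ}_{2l+1}$ outputs $1$ iff the number of $1$'s among its $2l+1$ input bits is at least $l+1$, and $0$ otherwise. A formula is a binary tree whose leaves are labeled by literals (variables or negated variables) and whose internal nodes are labeled by $\wedge$ or $\vee$; its size is its number of leaves. $L(f)$ denotes the minimum size of a formula computing $f$. $\binom{n}{k}$ is the binomial coefficient. *)

(* Defs.v *)
From mathcomp Require Import all_boot all_order all_algebra.
From mathcomp Require Import boolp.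

Set Implicit Arguments.
Unset Strict Implicit.
Unset Printing Implicit Defensive.

(* [Lit b i] is the variable [x_i] if [b = true] and its negation otherwise.
   There are no constant leaves. *)
Inductive formula (n : nat) : Type :=
| Lit of bool & 'I_n
| And of formula n & formula n
| Or of formula n & formula n.

Fixpoint eval n (F : formula n) (x : {ffun 'I_n -> bool}) : bool :=
  match F with
  | Lit b i => x i == b
  | And F1 F2 => eval F1 x && eval F2 x
  | Or F1 F2 => eval F1 x || eval F2 x
  end.

Fixpoint fsize n (F : formula n) : nat :=
  match F with
  | Lit _ _ => 1
  | And F1 F2 => fsize F1 + fsize F2
  | Or F1 F2 => fsize F1 + fsize F2
  end.

Definition computes n (F : formula n) (f : {ffun 'I_n -> bool} -> bool) : Prop :=
  forall x, eval F x = f x.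

(* Disjunctive normal form; constants are available only because there is at
   least one variable, whence the arity [n.+1]. *)
Lemma computes_exists n (f : {ffun 'I_n.+1 -> bool} -> bool) :
  exists F : formula n.+1, computes F f.
Proof.
pose T := Or (Lit true ord0) (Lit false ord0) : formula n.+1.
pose B := And (Lit true ord0) (Lit false ord0) : formula n.+1.
pose minterm (a : {ffun 'I_n.+1 -> bool}) :=
  foldr (fun i G => And (Lit (a i) i) G) T (enum 'I_n.+1).
have mintermE a x : eval (minterm a) x = (a == x).
  have -> : eval (minterm a) x = all (fun i => x i == a i) (enum 'I_n.+1).
    rewrite /minterm; elim: (enum _) => [|i s /= -> //].
    by rewrite /=; case: (x ord0).
  apply/allP/eqP => [h|-> //]; apply/ffunP => i.
  by apply/esym/eqP/h; rewrite mem_enum.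
exists (foldr (fun a G => Or (minterm a) G) B [seq a <- enum {ffun 'I_n.+1 -> bool} | f a]).
move=> x; transitivity (has (pred1 x) [seq a <- enum {ffun 'I_n.+1 -> bool} | f a]).
  elim: [seq _ <- _ | _] => [|a s /= ->]; last by rewrite mintermE.
  by rewrite /=; case: (x ord0).
by rewrite has_pred1 mem_filter mem_enum andbT.
Qed.

Lemma formula_size_exists n (f : {ffun 'I_n.+1 -> bool} -> bool) :
  exists m : nat, `[< exists2 F : formula n.+1, computes F f & fsize F = m >].
Proof.
by have [F hF] := computes_exists f; exists (fsize F); apply/asboolP; exists F.
Qed.

Definition L n (f : {ffun 'I_n.+1 -> bool} -> bool) : nat :=
  ex_minn (formula_size_exists f).

Definition MAJ (l : nat) (x : {ffun 'I_(2 * l).+1 -> bool}) : bool :=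
  (l.+1 <= #|[set i | x i]|)%N.

Local Open Scope ring_scope.

Definition epsilon (l : nat) : rat :=
  (l%:R ^+ 2 * (l%:R + 1)) / (6%:R * ('C((2 * l).+1, l)%N)%:R).

(* Main.v *)
(** Label a cell (x, y), with |x| = l+1 and |y| = l, by the leaf of the formula
    reached in the Karchmer-Wigderson game: this partitions the N x N matrix,
    N = C(2l+1, l), into as many rectangles as there are leaves, and a leaf
    determines a coordinate on which x and y differ.  The k_j distance-one
    cells (y included in x) of the rectangle j form a partial matching, so they
    span k_j^2 cells of it, called good.  Since the k_j add up to N (l+1),
    Cauchy-Schwarz bounds the number of leaves below by (N (l+1))^2 over the
    number of good cells; bounding the latter by N^2 is Khrapchenko's theorem.

    The gain comes from the 3 x 3 submatrices with rows U+{a,b}, U+{b,c},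
    U+{c,a} and columns U+{c}, U+{a}, U+{b} (copies of MAJ_3).  A good cell
    among the three at distance three shares its rectangle, with coordinate a
    (say), with another of them, so the three cannot all be good.  These
    submatrices are disjoint at distance three, hence at least
    N l^2 (l+1) / 6 = epsilon(l) N^2 cells are not good. *)

Require Import Defs.
From mathcomp Require Import all_boot all_order all_algebra.
From mathcomp Require Import zify ring lra.

Import Order.TTheory GRing.Theory Num.Theory.

(** * The Karchmer-Wigderson labelling, and Cauchy-Schwarz *)

(** By induction on [F]: at an [And] gate descend to a child rejecting [y], at an [Or] gate to a
    child accepting [x]. Each choice depends on only one of the two inputs, so the cells sharing a
    leaf form a rectangle. *)
Lemma formula_leaves n (F : formula n) :
  exists (leaf : {ffun 'I_n -> bool} -> {ffun 'I_n -> bool} -> 'I_(fsize F))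
         (var : 'I_(fsize F) -> 'I_n),
    (forall x y, eval F x -> ~~ eval F y ->
       x (var (leaf x y)) != y (var (leaf x y))) /\
    (forall x y x' y', eval F x -> ~~ eval F y -> eval F x' -> ~~ eval F y' ->
       leaf x y = leaf x' y' -> leaf x y' = leaf x y).
Proof.
elim: F => [b i|F1 [f1 [v1 [d1 r1]]] F2 [f2 [v2 [d2 r2]]]
               |F1 [f1 [v1 [d1 r1]]] F2 [f2 [v2 [d2 r2]]]] /=.
- exists (fun _ _ => ord0), (fun _ => i); split=> //= x y /eqP->.
  by rewrite eq_sym.
- exists (fun x y => if ~~ eval F1 y then lshift _ (f1 x y)
                     else rshift _ (f2 x y)),
    (fun j => match split j with inl j1 => v1 j1 | inr j2 => v2 j2 end).
  split=> [x y /andP[x1 x2]|x y x' y' /andP[x1 x2] + /andP[x1' x2']].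
    case: (boolP (eval F1 y)) => y1 y2 /=.
      by rewrite (unsplitK (inr _)); apply: d2.
    by rewrite (unsplitK (inl _)); apply: d1.
  case: (boolP (eval F1 y)) => y1 /= y2;
    case: (boolP (eval F1 y')) => y1' /= y2'.
  + by move=> /rshift_inj /r2 ->.
  + by move=> /eqP; rewrite eq_rlshift.
  + by move=> /eqP; rewrite eq_lrshift.
  + by move=> /lshift_inj /r1 ->.
- exists (fun x y => if eval F1 x then lshift _ (f1 x y)
                     else rshift _ (f2 x y)),
    (fun j => match split j with inl j1 => v1 j1 | inr j2 => v2 j2 end).
  split=> [x y + /norP[y1 y2]|x y x' y' + /norP[y1 y2] + /norP[y1' y2']].
    case: (boolP (eval F1 x)) => x1 x2 /=.
      by rewrite (unsplitK (inl _)); apply: d1.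
    by rewrite (unsplitK (inr _)); apply: d2.
  case: (boolP (eval F1 x)) => x1 /= x2;
    case: (boolP (eval F1 x')) => x1' /= x2'.
  + by move=> /lshift_inj /r1 ->.
  + by move=> /eqP; rewrite eq_lrshift.
  + by move=> /eqP; rewrite eq_rlshift.
  + by move=> /rshift_inj /r2 ->.
Qed.

(** Sum [2 * (k i * k j) <= k i ^ 2 + k j ^ 2] over all pairs of indices. *)
Lemma sum_sqr_le m (k : 'I_m -> nat) : (\sum_j k j) ^ 2 <= m * \sum_j k j ^ 2.
Proof.
rewrite -(leq_pmul2l (ltn0Sn 1)) -mulnn big_distrlr /= big_distrr /=.
have <- : \sum_(i < m) \sum_(j < m) (k i ^ 2 + k j ^ 2) =
    2 * (m * \sum_j k j ^ 2).
  rewrite (eq_bigr (fun i => m * k i ^ 2 + \sum_j k j ^ 2)); last first.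
    by move=> i _; rewrite big_split /= sum_nat_const card_ord.
  by rewrite big_split /= sum_nat_const card_ord -big_distrr /= mul2n addnn.
apply: leq_sum => i _; rewrite big_distrr /=; apply: leq_sum => j _.
exact: nat_Cauchy.
Qed.

Lemma cardsD1_pred (T : finType) (x : {set T}) i k :
  #|x| = k.+1 -> i \in x -> #|x :\ i| = k.
Proof. by move=> cx ix; move: (cardsD1 i x); rewrite cx ix => -[]. Qed.

(** * Khrapchenko's count for a partition into rectangles *)

Section Rectangles.

Variables (l m : nat).
Local Notation I := 'I_(2 * l).+1.
Variables (leaf : {set I} -> {set I} -> 'I_m) (var : 'I_m -> I).

Hypothesis var_diff : forall x y : {set I}, #|x| = l.+1 -> #|y| = l ->
  (var (leaf x y) \in x) != (var (leaf x y) \in y).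
Hypothesis leaf_rect : forall x y x' y' : {set I},
  #|x| = l.+1 -> #|y| = l -> #|x'| = l.+1 -> #|y'| = l ->
  leaf x y = leaf x' y' -> leaf x y' = leaf x y.

(* The cell [(x, y)] lies in the product of the two projections of the set of
   distance-one cells of its rectangle. *)
Definition good (x y : {set I}) : bool :=
  let j := leaf x y in let i := var j in
  [&& i \in x, i \notin y, leaf x (x :\ i) == j & leaf (i |: y) y == j].

Definition goods := [set p : {set I} * {set I} |
  [&& #|p.1| == l.+1, #|p.2| == l & good p.1 p.2]].

Definition bads := [set p : {set I} * {set I} |
  [&& #|p.1| == l.+1, #|p.2| == l, #|p.1 :\: p.2| == 2 & ~~ good p.1 p.2]].

(** By [var_diff], a distance-one cell of rectangle [j] in row [x] can only be [(x, x :\ var j)], so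
    these cells are counted by their rows. *)
Definition tops j :=
  [set x : {set I} | [&& #|x| == l.+1, var j \in x & leaf x (x :\ var j) == j]].

Definition bots j :=
  [set y : {set I} | [&& #|y| == l, var j \notin y & leaf (var j |: y) y == j]].

Lemma card_tops_le_bots j : #|tops j| <= #|bots j|.
Proof.
rewrite -(card_in_imset (f := fun x : {set I} => x :\ var j) (D := tops j)).
  apply/subset_leq_card/subsetP => y /imsetP[x].
  rewrite !inE => /and3P[/eqP cx jx /eqP lx] ->.
  by rewrite setD11 setD1K // lx (cardsD1_pred _ _ _ _ cx) ?eqxx.
move=> x x'; rewrite !inE => /and3P[_ jx _] /and3P[_ jx' _] e.
by rewrite -(setD1K jx) e setD1K.
Qed.

(** A row [x] has [l.+1] distance-one cells [(x, x :\ i)]. Their leaves are distinct, because [var]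
    recovers [i] from the leaf. *)
Lemma sum_card_tops : 'C((2 * l).+1, l) * l.+1 <= \sum_j #|tops j|.
Proof.
have <- : \sum_(x : {set I} | #|x| == l.+1) l.+1 = 'C((2 * l).+1, l) * l.+1.
  rewrite sum_nat_const; congr (_ * _).
  have := card_draws I l.+1; rewrite cardsE => ->.
  by rewrite card_ord -bin_sub; [congr 'C(_, _); lia | lia].
have -> : \sum_j #|tops j| =
    \sum_(x : {set I} | #|x| == l.+1) #|[set j | x \in tops j]|.
  transitivity (\sum_j \sum_(x : {set I} | #|x| == l.+1) (x \in tops j : nat)).
    apply: eq_bigr => j _; rewrite -sum1_card big_mkcond [RHS]big_mkcond.
    by apply: eq_bigr => x _; rewrite inE; case: (#|x| == _) => //=; case: ifP.
  rewrite exchange_big; apply: eq_bigr => x _.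
  rewrite -sum1_card [RHS]big_mkcond; apply: eq_bigr => j _.
  by rewrite inE; case: ifP.
apply: leq_sum => x /eqP cx; rewrite -{1}cx.
have vx i : i \in x -> var (leaf x (x :\ i)) = i.
  move=> ix; have cy : #|x :\ i| = l by apply: cardsD1_pred.
  have := var_diff _ _ cx cy; rewrite !inE.
  by have [//|_] := eqVneq (var (leaf x (x :\ i))) i; rewrite eqxx.
rewrite -(card_in_imset (f := fun i => leaf x (x :\ i)) (D := mem x)).
  apply/subset_leq_card/subsetP => j /imsetP[i ix ->].
  by rewrite !inE vx // cx !eqxx ix.
by move=> i i' ix ix' e; rewrite -(vx i ix) e vx.
Qed.

(** The row of one distance-one cell of rectangle [j] and the column of another meet inside
    rectangle [j], so [tops j] times [bots j] consists of good cells with leaf [j]. *)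
Lemma sum_sqr_tops : \sum_j #|tops j| ^ 2 <= #|goods|.
Proof.
have -> : #|goods| = \sum_j #|[set p in goods | leaf p.1 p.2 == j]|.
  rewrite -sum1_card (partition_big (fun p => leaf p.1 p.2) predT) //=.
  apply: eq_bigr => j _; rewrite -sum1_card; apply: eq_bigl => p.
  by rewrite !inE.
apply: leq_sum => j _; rewrite -mulnn.
apply: (leq_trans (leq_mul (leqnn _) (card_tops_le_bots j))).
rewrite -cardsX; apply/subset_leq_card/subsetP => -[x y].
rewrite !inE /= => /andP[/and3P[/eqP cx jx /eqP lx] /and3P[/eqP cy jy /eqP ly]].
have lj : leaf x y = j.
  rewrite -[RHS]lx; apply: (leaf_rect _ _ (var j |: y)) => //.
  - exact: cardsD1_pred.
  - by rewrite cardsU1 jy cy.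
  - by rewrite lx ly.
by rewrite /good lj cx cy jx jy lx ly !eqxx.
Qed.

Lemma card_goods_bads : #|goods| + #|bads| <= 'C((2 * l).+1, l) ^ 2.
Proof.
have -> : 'C((2 * l).+1, l) ^ 2 =
    #|setX [set x : {set I} | #|x| == l.+1] [set y : {set I} | #|y| == l]|.
  rewrite cardsX !card_draws card_ord -mulnn; congr (_ * _).
  by rewrite -bin_sub; [congr 'C(_, _); lia | lia].
have /eqP e : goods :&: bads == set0.
  apply/eqP/setP => p; rewrite !inE.
  by case: (good _ _); rewrite !(andbF, andbT).
rewrite -cardsUI e cards0 addn0; apply/subset_leq_card/subsetP => p.
by rewrite !inE => /orP[/and3P[-> ->]|/and4P[-> ->]].
Qed.

(** * Bad cells in copies of MAJ_3 *)

(** The coordinate lies in the row but not in the column, so it is [a] or [b]. If it is [a],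
    goodness puts (U+{a,b}, U+{b}) and (U+{a,c}, U+{c}) in the rectangle, hence also their crossing
    (U+{c,a}, U+{b}). The case of [b] is symmetric. *)
Lemma good_pair (U : {set I}) a b c : #|U|.+1 = l ->
  a \notin U -> b \notin U -> c \notin U -> a != b -> b != c -> a != c ->
  good (a |: (b |: U)) (c |: U) ->
  (var (leaf (a |: (b |: U)) (c |: U)) = a /\
   leaf (a |: (b |: U)) (c |: U) = leaf (c |: (a |: U)) (b |: U)) \/
  (var (leaf (a |: (b |: U)) (c |: U)) = b /\
   leaf (a |: (b |: U)) (c |: U) = leaf (b |: (c |: U)) (a |: U)).
Proof.
move=> cS aS bS cS' ab bc ac; rewrite /good => /and4P[+ + /eqP + /eqP].
have c2 u v : u != v -> u \notin U -> v \notin U -> #|u |: (v |: U)| = l.+1.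
  move=> uv uS vS.
  by rewrite !cardsU1 !inE (negPf uv) (negPf uS) vS /= !add1n cS.
have c1 u : u \notin U -> #|u |: U| = l.
  by move=> uS; rewrite cardsU1 uS add1n cS.
set j := leaf _ (c |: U); rewrite !inE => /or3P[/eqP e|/eqP e|iS].
- rewrite e => _; rewrite setU1K ?inE ?negb_or ?ab // => l1 l2; left; split=> //.
  rewrite [c |: _]setUCA -{1}l2; symmetry.
  by apply: (leaf_rect _ _ (a |: (b |: U))); rewrite ?l1 ?l2 ?c1 ?c2.
- rewrite e => _; rewrite [a |: (b |: U)]setUCA.
  rewrite setU1K ?inE ?negb_or 1?eq_sym ?ab //; move=> l1 l2; right; split=> //; rewrite -{1}l2; symmetry.
  apply: (leaf_rect _ _ (b |: (a |: U))); rewrite ?l1 ?l2 ?c1 ?c2 //.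
  by rewrite eq_sym.
- by rewrite iS orbT.
Qed.

(** If all three were good, two of them would share a leaf and its coordinate, and the third would
    have to share a leaf with one of these two under a different coordinate. *)
Lemma bad_exists (U : {set I}) a b c : #|U|.+1 = l ->
  a \notin U -> b \notin U -> c \notin U -> a != b -> b != c -> a != c ->
  [|| ~~ good (a |: (b |: U)) (c |: U), ~~ good (b |: (c |: U)) (a |: U)
    | ~~ good (c |: (a |: U)) (b |: U)].
Proof.
move=> cS aS bS cS' ab bc ac; rewrite -!negb_and; apply/negP => /and3P[].
have ba : b != a by rewrite eq_sym.
have ca : c != a by rewrite eq_sym.
have cb : c != b by rewrite eq_sym.
move=> /good_pair-/(_ cS aS bS cS' ab bc ac) gu.
move=> /good_pair-/(_ cS bS cS' aS bc ca ba) gw.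
move=> /good_pair-/(_ cS cS' aS bS ca ab cb) gv.
move: (leaf _ _) (leaf _ _) (leaf _ _) gu gw gv => u v w.
move/eqP: ab => ab; move/eqP: bc => bc; move/eqP: ac => ac.
by case=> -[e1 e2] [] [e3 e4] [] [e5 e6]; congruence.
Qed.

(** * Counting the submatrices and their bad cells *)

Local Notation quad := ({set I} * (I * I * I))%type.

(* [(U, (a, b, c))] encodes an ordered 3 x 3 submatrix, [bad3] looks at its
   cell in row [U + {a, b}] and column [U + {c}]. *)
Definition distinct3 : {set quad} := [set p : quad |
  let: (U, (a, b, c)) := p in
  [&& #|U|.+1 == l, a \notin U, b \notin a |: U & c \notin b |: (a |: U)]].

Definition rot3 (p : quad) : quad := let: (U, (a, b, c)) := p in (U, (b, c, a)).

Definition bad3 (p : quad) : bool :=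
  let: (U, (a, b, c)) := p in ~~ good (a |: (b |: U)) (c |: U).

Lemma distinct3P (U : {set I}) (a b c : I) : reflect
  ([/\ #|U|.+1 = l, a \notin U, b \notin U & c \notin U] /\
   [/\ a != b, b != c & a != c]) ((U, (a, b, c)) \in distinct3).
Proof.
rewrite inE !inE !negb_or; apply: (iffP idP).
  move=> /and4P[/eqP -> -> /andP[ba ->] /and3P[cb ca ->]].
  by rewrite eq_sym ba eq_sym cb eq_sym ca.
case=> -[-> -> -> ->] [ab bc ac]; rewrite eqxx /= !andbT.
by rewrite eq_sym ab eq_sym bc eq_sym ac.
Qed.

Lemma rot3_inj : injective rot3.
Proof. by case=> [U [[a b] c]] [U' [[a' b'] c']] [-> -> -> ->]. Qed.

Lemma rot3_distinct3 p : (rot3 p \in distinct3) = (p \in distinct3).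
Proof.
case: p => [U [[a b] c]]; apply/distinct3P/distinct3P => -[[? ? ? ?] [? ? ?]].
  by do 2!split=> //; rewrite eq_sym.
by do 2!split=> //; rewrite eq_sym.
Qed.

(** The map [rot3] permutes [distinct3], and its iterates visit the three distance-three cells of a
    submatrix, so [bad_exists] can be summed over rotations. *)
Lemma card_distinct3_le : #|distinct3| <= 3 * \sum_(p in distinct3) bad3 p.
Proof.
have rotE (w : quad -> nat) :
    \sum_(p in distinct3) w p = \sum_(p in distinct3) w (rot3 p).
  by rewrite (reindex_inj rot3_inj); apply: eq_bigl => p; rewrite rot3_distinct3.
have -> : 3 * \sum_(p in distinct3) bad3 p =
    \sum_(p in distinct3) (bad3 p + bad3 (rot3 p) + bad3 (rot3 (rot3 p))).
  rewrite !big_split /= -(rotE (fun p => bad3 (rot3 p) : nat)) -(rotE bad3).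
  by move: (\sum_(_ in _) _) => X; lia.
rewrite -sum1_card; apply: leq_sum => -[U [[a b] c]] /distinct3P[[cS aS bS cS']].
case=> ab bc ac /=; have := bad_exists _ _ _ _ cS aS bS cS' ab bc ac.
by do 3!case: (good _ _).
Qed.

Lemma card_distinct3 : #|distinct3| = 'C((2 * l).+1, l) * (l.+1 * l ^ 2).
Proof.
have cC (A : {set I}) : #|[pred i | i \notin A]| = (2 * l).+1 - #|A|.
  transitivity #|~: A|; first by apply: eq_card => i; rewrite !inE.
  have := cardsC A; rewrite card_ord.
  by move: #|A| #|~: A| => p q <-; rewrite addKn.
transitivity (\sum_(U : {set I} | #|U|.+1 == l) \sum_(a | a \notin U)
   \sum_(b | b \notin a |: U) \sum_(c | c \notin b |: (a |: U)) 1).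
  under eq_bigr do under eq_bigr do rewrite pair_big_dep.
  under eq_bigr do rewrite pair_big_dep.
  rewrite pair_big_dep /= -sum1_card.
  rewrite (reindex (fun p : {set I} * (I * (I * I)) =>
     (p.1, (p.2.1, p.2.2.1, p.2.2.2)))) /=.
    by apply: eq_bigl => -[U [a [b c]]]; rewrite inE.
  exists (fun p => (p.1, (p.2.1.1, (p.2.1.2, p.2.2)))).
    by case=> [U [a [b c]]].
  by case=> [U [[a b] c]].
transitivity (\sum_(U : {set I} | #|U|.+1 == l) (l.+2 * l.+1 * l)).
  apply: eq_bigr => U /eqP cS.
  rewrite (eq_bigr (fun=> l.+1 * l)).
    by rewrite sum_nat_const cC -mulnA; congr (_ * _); lia.
  move=> a aS; rewrite (eq_bigr (fun=> l)).
    by rewrite sum_nat_const cC cardsU1 aS; congr (_ * _); lia.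
  move=> b bS; rewrite sum_nat_const cC cardsU1 bS cardsU1 aS; lia.
(* The size of [U] is [l.-1] only for positive [l], so [l = 0] is set apart. *)
rewrite sum_nat_const; case: (posnP l) => [->|l0]; first by rewrite !muln0.
have -> : #|[pred U : {set I} | #|U|.+1 == l]| = 'C((2 * l).+1, l.-1).
  have := card_draws I l.-1; rewrite card_ord => <-.
  by apply: eq_card => U; rewrite !inE; lia.
(* This gives [l * 'C((2 * l).+1, l) = l.+2 * 'C((2 * l).+1, l.-1)], which absorbs the factor
   [l.+2]. *)
have := mul_bin_left (2 * l).+1 l.-1; rewrite prednK //.
have -> : (2 * l).+1 - l.-1 = l.+2 by lia.
by nia.
Qed.

(** A cell (x, y) determines [U] as the intersection of x and y, then [c] and the unordered pair of
    [a] and [b]. It therefore comes from at most two quadruples. *)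
Lemma sum_bad3 : \sum_(p in distinct3) bad3 p <= 2 * #|bads|.
Proof.
(* Recording [a] orders the pair x \ y, which makes [h] injective. *)
pose h (p : quad) := let: (U, (a, b, c)) := p in ((a |: (b |: U), c |: U), a).
pose D := [set p in distinct3 | bad3 p].
have -> : \sum_(p in distinct3) bad3 p = #|D|.
  rewrite -sum1_card big_mkcond [RHS]big_mkcond; apply: eq_bigr => p _.
  by rewrite [p \in D]in_set; case: (p \in distinct3); case: (bad3 p).
pose E := [set q : {set I} * {set I} * I |
  (q.1 \in bads) && (q.2 \in q.1.1 :\: q.1.2)].
have -> : 2 * #|bads| = #|E|.
  transitivity (\sum_(q in bads) \sum_(i in q.1 :\: q.2) 1).
    rewrite mulnC -sum_nat_const; apply: eq_bigr => q; rewrite inE.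
    by case/and4P => _ _ /eqP e _; rewrite sum1_card e.
  by rewrite pair_big_dep /= -sum1_card; apply: eq_bigl => q; rewrite [RHS]inE.
rewrite -(card_in_imset (f := h) (D := D)).
  apply/subset_leq_card/subsetP => _ /imsetP[[U [[a b] c]] pD ->].
  move: pD; rewrite inE => /andP[/distinct3P[[cS aS bS cS'] [ab bc ac]] bad].
  have xy : (a |: (b |: U)) :\: (c |: U) = [set a; b].
    apply/setP => i; rewrite !inE; case: (eqVneq i a) => [->|_] /=.
      by rewrite (negPf ac) (negPf aS).
    case: (eqVneq i b) => [->|_] /=; first by rewrite (negPf bc) (negPf bS).
    by case: (i \in U); rewrite ?orbT ?andbF.
  rewrite /h !inE /= xy cards2 ab (bad : ~~ good _ _) !andbT negb_or ac aS !eqxx.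
  by rewrite !cardsU1 !inE negb_or ab aS bS cS' /= !add1n cS !eqxx.
move=> [U [[a b] c]] [U' [[a' b'] c']].
rewrite inE => /andP[/distinct3P[[cS aS bS cS'] [ab bc ac]] _].
rewrite inE => /andP[/distinct3P[[dS aT bT cT] [ab' bc' ac']] _] /=.
case=> ex ey ea; rewrite -ea {a' ea} in ex aT ab' ac' *.
have eS : U = U'.
  have h1 (T : {set I}) u v w : u \notin T -> v \notin T -> w \notin T ->
      u != w -> v != w -> (u |: (v |: T)) :&: (w |: T) = T.
    move=> uT vT wT uw vw; apply/setP => i; rewrite !inE.
    case: (eqVneq i u) => [->|_] /=; first by rewrite (negPf uw).
    case: (eqVneq i v) => [->|_] /=; first by rewrite (negPf vw).
    by case: (i \in T); rewrite ?orbT ?andbF.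
  by rewrite -(h1 U a b c) // -(h1 U' a b' c') // ex ey.
rewrite -eS {U' eS dS} in ex ey aT bT cT *.
have -> : c = c'.
  by move/setP/(_ c): ey; rewrite !inE eqxx (negPf cS') !orbF => /esym/eqP.
have -> // : b = b'.
move/setP/(_ b): ex; rewrite !inE eqxx (negPf bS) !orbF eq_sym (negPf ab) /=.
by move/esym/eqP.
Qed.

(** Here [G] is the number of good cells. The factor 6 is 3 rotations per submatrix times 2
    quadruples per bad cell. *)
Lemma rectangle_bound : exists G : nat,
  ('C((2 * l).+1, l) * l.+1) ^ 2 <= m * G /\
  6 * G + 'C((2 * l).+1, l) * (l.+1 * l ^ 2) <= 6 * 'C((2 * l).+1, l) ^ 2.
Proof.
exists #|goods|; split.
  apply: leq_trans (leq_mul (leqnn m) sum_sqr_tops).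
  apply: leq_trans (sum_sqr_le _ _).
  by rewrite leq_exp2r // sum_card_tops.
have := card_goods_bads; have := card_distinct3_le; have := sum_bad3.
rewrite card_distinct3; lia.
Qed.

End Rectangles.

Local Open Scope ring_scope.

Theorem theorem4p1 (l : nat) (hl : (1 <= l)%N) :
  (L (@MAJ l))%:R >= (l%:R + 1) ^+ 2 / (1 - epsilon l) :> rat.
Proof.
rewrite /L; case: ex_minnP => m /boolp.asboolP[F FM <-] _.
have [leaf [var [var_diff leaf_rect]]] := formula_leaves _ F.
(* Indicator functions turn the sets of the matrix into inputs of [F]. *)
pose chi (x : {set 'I_(2 * l).+1%N}) : {ffun 'I_(2 * l).+1%N -> bool} :=
  [ffun i => i \in x].
have chiK x : [set i | chi x i] = x by apply/setP => i; rewrite inE ffunE.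
have chi1 (x : {set 'I_(2 * l).+1%N}) : #|x| = l.+1 -> eval F (chi x).
  by move=> cx; rewrite FM /MAJ chiK cx.
have chi0 (x : {set 'I_(2 * l).+1%N}) : #|x| = l -> ~~ eval F (chi x).
  by move=> cx; rewrite FM /MAJ chiK cx ltnn.
have [] := @rectangle_bound l (fsize F) (fun x y => leaf (chi x) (chi y)) var.
- by move=> x y /chi1 cx /chi0 cy; have := var_diff _ _ cx cy; rewrite !ffunE.
- by move=> x y x' y' /chi1 ? /chi0 ? /chi1 ? /chi0 ?; apply: leaf_rect.
have : (0 < 'C((2 * l).+1, l))%N by rewrite bin_gt0; lia.
rewrite /epsilon; move: 'C(_, _) (fsize F) => N s N0 G.
rewrite -!(ler_nat rat) !(natrD, natrM, natrX) -natr1.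
have {}N0 : (0 : rat) < N%:R by rewrite ltr0n.
have s0 : (0 : rat) <= s%:R by rewrite ler0n.
have l0 : (0 : rat) <= l%:R by rewrite ler0n.
have G0 : (0 : rat) <= G%:R by rewrite ler0n.
move: (N%:R) (s%:R) (l%:R) (G%:R) N0 s0 l0 G0 => c t k g N0 s0 l0 G0 [h1 h2].
set e := (k ^+ 2 * _) / _.
(* The deficit of good cells is thus exactly [c ^+ 2 * e], with [c] the binomial coefficient. *)
have eE : 6 * c ^+ 2 * (1 - e) = 6 * c ^+ 2 - c * ((k + 1) * k ^+ 2).
  by rewrite /e; field; rewrite gt_eqF.
have GE : g <= c ^+ 2 * (1 - e) by lra.
have h3 : c ^+ 2 * (k + 1) ^+ 2 <= c ^+ 2 * (t * (1 - e)).
  by rewrite -exprMn (le_trans h1) // mulrCA ler_wpM2l.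
have N2 : 0 < c ^+ 2 by rewrite exprn_gt0.
rewrite ler_pM2l // in h3.
have l1 : 0 < (k + 1) ^+ 2 by rewrite exprn_gt0 //; lra.
(* Positivity of the denominator comes from [h3]: a nonpositive [1 - e] would make [t * (1 - e)]
   nonpositive, yet it is at least [(k + 1) ^+ 2]. *)
have e1 : 0 < 1 - e.
  rewrite ltNge; apply/negP => e0.
  have : t * (1 - e) <= 0 by rewrite mulr_ge0_le0.
  by lra.
by rewrite ler_pdivrMr.
Qed.
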